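(* Let $G$ and $H$ be finite simple connected graphs, each with at least two vertices. If $o(H)\in\{\mathcal{N},\mathcal{S}\}$, then $o(G\circ H)=\mathcal{S}$.
   Context: The lexicographic product $G\circ H$ has vertex set $V(G)\times V(H)$, with $(g,h)(g',h')$ an edge iff $gg'\in E(G)$, or $g=g'$ and $hh'\in E(H)$. A set $W\subseteq V(X)$ is a resolving set of a connected graph $X$ if for every two distinct vertices $x,y$ there is $z\in W$ with $d(x,z)\ne d(y,z)$. In the Maker-Breaker resolving game on $X$, Resolver and Spoiler alternately select unplayed vertices of $X$; Resolver wins if the vertices he selects contain a resolving set of $X$, and Spoiler wins if she selects at least one vertex of every resolving set of $X$. The outcome $o(X)$ is $\mathcal{R}$ if Resolver has a winning strategy no matter who starts, $\mathcal{S}$ if Spoiler has a winning strategy no matter who starts, and $\mathcal{N}$ if the first player has a winning strategy. *)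

(* Defs.v *)
From HB Require Import structures.
From mathcomp Require Import all_boot.

Set Implicit Arguments.
Unset Strict Implicit.
Unset Printing Implicit Defensive.

Record sgraph := SGraph {
  vertex :> finType;
  adj : rel vertex;
  adj_sym : symmetric adj;
  adj_irrefl : irreflexive adj
}.

Definition connected (X : sgraph) : Prop :=
  forall x y : X, connect (@adj X) x y.

Definition walk_of_length (X : sgraph) (x y : X) (k : nat) : bool :=
  [exists p : k.-tuple X, path (@adj X) x p && (last x p == y)].

(* Least length of a walk from x to y; a shortest walk has length < #|X|, so
   the search bound loses nothing, and #|X| is a dummy value for unreachable
   pairs (never attained in a connected graph). *)
Definition dist (X : sgraph) (x y : X) : nat :=
  find (walk_of_length x y) (iota 0 #|X|).

Definition resolving (X : sgraph) (W : {set X}) : Prop :=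
  forall x y : X, x != y -> exists2 z, z \in W & dist x z != dist y z.

Section LexProduct.
Variables G H : sgraph.

Definition lex_adj : rel (G * H) := fun u v =>
  adj u.1 v.1 || (u.1 == v.1) && adj u.2 v.2.

Lemma lex_adj_sym : symmetric lex_adj.
Proof.
by move=> u v; rewrite /lex_adj adj_sym eq_sym [adj u.2 _]adj_sym.
Qed.

Lemma lex_adj_irrefl : irreflexive lex_adj.
Proof. by move=> u; rewrite /lex_adj !adj_irrefl andbF. Qed.

Definition lex_product : sgraph := SGraph lex_adj_sym lex_adj_irrefl.
End LexProduct.

Inductive player := Resolver | Spoiler.

Definition is_resolver (p : player) : bool :=
  if p is Resolver then true else false.
Definition player_of_bool (b : bool) : player :=
  if b then Resolver else Spoiler.
Lemma is_resolverK : cancel is_resolver player_of_bool.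
Proof. by case. Qed.
HB.instance Definition _ := Equality.copy player (can_type is_resolverK).

Definition opponent (p : player) : player :=
  if p is Resolver then Spoiler else Resolver.

(* The player making move number k (counted from 0). *)
Definition mover (first : player) (k : nat) : player :=
  if odd k then opponent first else first.

Section Game.
Variable X : sgraph.
Implicit Types (p first : player) (s h : seq X).

(* A position or play is the duplicate-free sequence of vertices selected so
   far, in chronological order. *)
Definition selected first p s : {set X} :=
  [set x in s | mover first (index x s) == p].

Definition wins first p s : Prop :=
  match p with
  | Resolver => exists2 W : {set X},
      resolving W & W \subset selected first Resolver s
  | Spoiler => forall W : {set X}, resolving W ->
      exists2 x, x \in W & x \in selected first Spoiler s
  end.

Definition complete_play s : Prop := uniq s /\ size s = #|X|.

Definition strategy := seq X -> X.

Definition legal first p (sigma : strategy) : Prop :=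
  forall h, uniq h -> size h < #|X| -> mover first (size h) = p ->
    sigma h \notin h.

Definition follows first p (sigma : strategy) s : Prop :=
  forall h x, prefix (rcons h x) s -> mover first (size h) = p ->
    x = sigma h.

(* Both winning conditions are preserved by further moves, so a game that is
   won early may be played on until every vertex is selected. *)
Definition has_winning_strategy first p : Prop :=
  exists sigma : strategy, legal first p sigma /\
    forall s, complete_play s -> follows first p sigma s -> wins first p s.
End Game.

Inductive outcome := OutR | OutN | OutS.

Definition has_outcome (X : sgraph) (o : outcome) : Prop :=
  match o with
  | OutR => forall first, has_winning_strategy X first Resolver
  | OutS => forall first, has_winning_strategy X first Spoiler
  | OutN => forall first, has_winning_strategy X first first
  end.

(* Main.v *)
Require Import Defs.
From mathcomp Require Import all_boot.

(** Inside a single copy [{g} x H] of [H], two vertices are separated only by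
    vertices of that same copy, and distances there are distances of [H]
    truncated at 2.  Hence a resolving set of the product meets every copy in
    a resolving set of [H], and Spoiler wins as soon as she hits all resolving
    sets of [H] within one copy.  Both outcomes N and S let her do so when she
    moves first, so she plays that strategy in a copy that Resolver's opening
    move missed: there is one because [G] has two vertices.  Whenever Resolver
    plays outside the copy she makes an arbitrary extra move, which never harms
    her. *)

Set Implicit Arguments.
Unset Strict Implicit.
Unset Printing Implicit Defensive.

(** * Positional games *)

Lemma setD1_ind (T : finType) (K : {set T} -> Prop) :
  (forall A : {set T}, (forall x, x \in A -> K (A :\ x)) -> K A) ->
  forall A : {set T}, K A.
Proof.
move=> KD1 A; have [n] := ubnP #|A|; elim: n A => // n IHn A leAn.
apply: KD1 => x Ax; apply: IHn.
by move: leAn; rewrite (cardsD1 x) Ax.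
Qed.

Lemma imsetD1 (T T' : finType) (f : T -> T') (A : {set T}) x :
  injective f -> f @: (A :\ x) = (f @: A) :\ f x.
Proof.
move=> f_inj; apply/setP=> y; apply/imsetP/setD1P=> [[z]|[yfx /imsetP[z Az eyz]]].
  by rewrite !inE => /andP[zx Az] ->; rewrite (inj_eq f_inj) imset_f.
by exists z => //; rewrite !inE Az andbT; apply: contraNneq yfx => <-; rewrite eyz.
Qed.

Fixpoint forces_rec (T : finType) (P : pred {set T}) (n : nat) (b : bool)
    (F S : {set T}) : bool :=
  if n is n'.+1 then
    if b then [exists x in F, forces_rec P n' false (F :\ x) (x |: S)]
    else [forall x in F, forces_rec P n' true (F :\ x) S]
  else P S.

(* Two players alternately take elements of [F] until none is left; the player
   who already owns [S], and who is to move iff [b], can make her final set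
   satisfy [P]. *)
Definition forces (T : finType) (P : pred {set T}) (b : bool)
    (F S : {set T}) : bool :=
  forces_rec P #|F| b F S.

Lemma forcesE (T : finType) (P : pred {set T}) b (F S : {set T}) :
  forces P b F S =
  if F == set0 then P S
  else if b then [exists x in F, forces P false (F :\ x) (x |: S)]
  else [forall x in F, forces P true (F :\ x) S].
Proof.
rewrite {1}/forces -cards_eq0; case cardF: #|F| => [|n] //=.
have cardFD1 x : x \in F -> #|F :\ x| = n.
  by move=> Fx; move: cardF; rewrite (cardsD1 x) Fx => -[].
case: b.
- by apply: eq_existsb => x; apply: andb_id2l => /cardFD1 <-.
- by apply: eq_forallb => x; apply: implyb_id2l => /cardFD1 <-.
Qed.

Lemma forces0 (T : finType) (P : pred {set T}) b (S : {set T}) :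
  forces P b set0 S = P S.
Proof. by rewrite forcesE eqxx. Qed.

Lemma forces_stepE (T : finType) (P : pred {set T}) b (F S : {set T}) x :
  x \in F ->
  forces P b F S =
  if b then [exists y in F, forces P false (F :\ y) (y |: S)]
  else [forall y in F, forces P true (F :\ y) S].
Proof. by move=> Fx; rewrite forcesE ifN //; apply/set0Pn; exists x. Qed.
Arguments forces_stepE {T P b F S x}.

Lemma forces_move (T : finType) (P : pred {set T}) (F S : {set T}) x :
  x \in F -> forces P false (F :\ x) (x |: S) -> forces P true F S.
Proof. by move=> Fx win; rewrite (forces_stepE Fx); apply/exists_inP; exists x. Qed.

Lemma forces_reply (T : finType) (P : pred {set T}) (F S : {set T}) x :
  x \in F -> forces P false F S -> forces P true (F :\ x) S.
Proof. by move=> Fx; rewrite (forces_stepE Fx) => /forall_inP; apply. Qed.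

Lemma forces_imset (T T' : finType) (f : T -> T') (P : pred {set T})
    (P' : pred {set T'}) b (F S : {set T}) :
  injective f -> (forall A : {set T}, P A -> P' (f @: A)) ->
  forces P b F S -> forces P' b (f @: F) (f @: S).
Proof.
move=> f_inj PP'; elim/setD1_ind: F b S => F IHF b S.
rewrite (forcesE P) (forcesE P') imset_eq0; case: ifP => _; first exact: PP'.
case: b => [/exists_inP[x Fx win] | /forall_inP win].
- apply/exists_inP; exists (f x); first exact: imset_f.
  by rewrite -imsetD1 // -imsetU1; apply: IHF.
- apply/forall_inP=> _ /imsetP[x Fx ->].
  by rewrite -imsetD1 //; apply: IHF (win x Fx).
Qed.

Section MonotoneGoal.
Variables (T : finType) (P : pred {set T}).
Hypothesis monoP : forall A B : {set T}, A \subset B -> P A -> P B.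
Implicit Types (F S : {set T}).

(* If her winning move is the very element [x] she is given, her own move is yet
   another gift, on the smaller board. *)
Lemma forces_gain b F S x :
  x \in F -> forces P b F S -> forces P b (F :\ x) (x |: S).
Proof.
elim/setD1_ind: F b S x => F IHF [] S x Fx.
- rewrite (forces_stepE Fx).
  case/exists_inP=> y Fy win; have [eyx | yx] := eqVneq y x.
    rewrite eyx in win; have [F0 | [z FDz]] := set_0Vmem (F :\ x).
      by move: win; rewrite F0 !forces0.
    exact: forces_move FDz (IHF x Fx _ _ _ FDz win).
  apply: (forces_move (x := y)); first by rewrite !inE yx.
  by rewrite setDDl setUC -setDDl setUCA; apply: IHF; rewrite ?inE 1?eq_sym ?yx.
- move=> win; rewrite forcesE; case: ifPn => [/eqP FD0 | _].
    have := forces_reply Fx win; rewrite FD0 forces0.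
    by apply: monoP; apply: subsetUr.
  apply/forall_inP=> y; rewrite !inE => /andP[yx Fy].
  rewrite setDDl setUC -setDDl; apply: IHF => //; last exact: forces_reply.
  by rewrite !inE eq_sym yx.
Qed.

Lemma forces_to_move b F S : forces P false F S -> forces P b F S.
Proof.
case: b => // win; have [F0 | [x Fx]] := set_0Vmem F.
  by move: win; rewrite F0 !forces0.
exact: forces_move Fx (forces_gain Fx win).
Qed.

Lemma forces_sub_board b F F' S :
  F \subset F' -> forces P b F S -> forces P b F' S.
Proof.
elim/setD1_ind: F' F b S => F' IHF' F b S sFF' win.
have [F'0 | [z F'z]] := set_0Vmem F'.
  by move: sFF' win; rewrite F'0 subset0 => /eqP->.
case: b win => win.
- have [F0 | [y Fy]] := set_0Vmem F.
    apply: (forces_move F'z); apply: (IHF' z F'z F); first by rewrite F0 sub0set.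
    by move: win; rewrite F0 !forces0; apply: monoP; apply: subsetUr.
  move: win; rewrite (forces_stepE Fy).
  case/exists_inP=> x Fx win; have F'x := subsetP sFF' x Fx.
  exact: forces_move F'x (IHF' x F'x _ _ _ (setSD _ sFF') win).
- rewrite (forces_stepE F'z).
  apply/forall_inP=> y F'y; have [Fy | nFy] := boolP (y \in F).
    exact: IHF' F'y _ _ _ (setSD _ sFF') (forces_reply Fy win).
  apply: (IHF' y F'y F); last exact: forces_to_move.
  by rewrite subsetD1 sFF'.
Qed.
End MonotoneGoal.

(** * Strategies in the resolving game *)

Section ResolvingGame.
Variable X : sgraph.
Implicit Types (p first : player) (s h : seq X) (S W : {set X}).

Definition resolvingb W : bool :=
  [forall x, forall y, (x != y) ==> [exists z in W, dist x z != dist y z]].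

Lemma resolvingP W : reflect (resolving W) (resolvingb W).
Proof.
apply: (iffP 'forall_forallP) => [res x y xy | res x y].
  by have /implyP/(_ xy)/exists_inP := res x y.
by apply/implyP=> xy; apply/exists_inP; exact: res.
Qed.

Lemma resolvingS W W' : W \subset W' -> resolving W -> resolving W'.
Proof.
move=> /subsetP sWW' res x y /res[z Wz xyz].
by exists z; first exact: sWW'.
Qed.

(* A superset of a resolving set is resolving, so [S] meets every resolving set
   iff its complement is not resolving. *)
Definition winning_set p S : bool :=
  if p is Resolver then resolvingb S else ~~ resolvingb (~: S).

Lemma winning_setS p S S' : S \subset S' -> winning_set p S -> winning_set p S'.
Proof.
case: p => sSS' /=; first by move/resolvingP/(resolvingS sSS')/resolvingP.
by apply: contra => /resolvingP res; apply/resolvingP/resolvingS/res; rewrite setCS.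
Qed.

Lemma winsP first p s :
  reflect (wins first p s) (winning_set p (selected first p s)).
Proof.
case: p => /=; first apply: (iffP (resolvingP _)).
- by move=> res; exists (selected first Resolver s).
- by case=> W res sW; apply: resolvingS res.
apply: (iffP idP) => [/resolvingP nres W res | hit].
- apply/exists_inP; apply: contra_notT nres => /exists_inPn disjWS.
  by apply: resolvingS res; apply/subsetP=> x /disjWS; rewrite in_setC.
- by apply/resolvingP=> /hit[x]; rewrite in_setC => /negP.
Qed.

Definition unplayed h : {set X} := ~: [set x in h].

Lemma in_unplayed h x : (x \in unplayed h) = (x \notin h).
Proof. by rewrite !inE. Qed.

Lemma unplayed_rcons h x : unplayed (rcons h x) = unplayed h :\ x.
Proof. by apply/setP=> y; rewrite !inE mem_rcons inE negb_or. Qed.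

Lemma card_unplayed h : uniq h -> #|unplayed h| = #|X| - size h.
Proof. by move=> uh; rewrite cardsCs setCK cardsE (card_uniqP uh). Qed.

Lemma mover_succ first p k : (mover first k.+1 == p) = (mover first k != p).
Proof. by rewrite /mover /=; case: odd; case: first; case: p. Qed.

Lemma selected_rcons first p h x : x \notin h ->
  selected first p (rcons h x) =
  if mover first (size h) == p then x |: selected first p h
  else selected first p h.
Proof.
move=> hx; apply/setP=> y; rewrite !inE mem_rcons inE -cats1 index_cat.
have [->|yx] := eqVneq y x.
  rewrite (negPf hx) /= eqxx addn0.
  by case: ifP => mp; rewrite !inE ?eqxx // (negPf hx).
by case: (mover _ (size h) == p); rewrite !inE ?(negPf yx) /=; case: (y \in h).
Qed.

Definition forces_after first p h : bool :=
  forces (winning_set p) (mover first (size h) == p) (unplayed h)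
    (selected first p h).

Lemma forces_afterE first p h :
  forces_after first p h =
  if unplayed h == set0 then winning_set p (selected first p h)
  else if mover first (size h) == p
  then [exists x in unplayed h, forces_after first p (rcons h x)]
  else [forall x in unplayed h, forces_after first p (rcons h x)].
Proof.
rewrite [LHS]forcesE; case: ifP => // _; case: ifP => mp.
- apply: eq_existsb => x; apply: andb_id2l; rewrite in_unplayed => hx.
  by rewrite /forces_after size_rcons mover_succ unplayed_rcons selected_rcons ?mp.
- apply: eq_forallb => x; apply: implyb_id2l; rewrite in_unplayed => hx.
  by rewrite /forces_after size_rcons mover_succ unplayed_rcons selected_rcons ?mp.
Qed.

Lemma forces_after_nil first p :
  forces_after first p [::] = forces (winning_set p) (first == p) setT set0.
Proof. by congr forces; apply/setP=> x; rewrite !inE. Qed.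

Lemma forces_after_complete first p s :
  complete_play s -> forces_after first p s -> wins first p s.
Proof.
case=> us szs; rewrite forces_afterE -cards_eq0 card_unplayed // szs subnn.
by move/winsP.
Qed.

Lemma follows_rcons first p (sigma : strategy X) h x :
  follows first p sigma h ->
  (mover first (size h) = p -> x = sigma h) ->
  follows first p sigma (rcons h x).
Proof.
move=> fol hx k y /prefixP[t]; case/lastP: t => [|t z].
  by rewrite cats0 => /rcons_inj[<- <-].
rewrite -rcons_cat => /rcons_inj[eh _]; apply: fol.
by apply/prefixP; exists t.
Qed.

Lemma winning_strategy_forces first p :
  has_winning_strategy X first p ->
  forces (winning_set p) (first == p) setT set0.
Proof.
case=> sigma [leg win]; rewrite -forces_after_nil.
suff forces_following F h : unplayed h = F -> uniq h -> size h <= #|X| ->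
    follows first p sigma h -> forces_after first p h.
  by apply: (forces_following _ [::]) => // h x; case: h.
elim/setD1_ind: F h => F IHF h eF uh szh fol.
have forces_rcons x : x \in unplayed h ->
    (mover first (size h) = p -> x = sigma h) -> forces_after first p (rcons h x).
  move=> hx sx; apply: (IHF x); rewrite -?eF //; first exact: unplayed_rcons.
  - by rewrite rcons_uniq uh -in_unplayed hx.
  - rewrite size_rcons -subn_gt0 -card_unplayed //; apply/card_gt0P.
    by exists x.
  - exact: follows_rcons.
rewrite forces_afterE -cards_eq0 card_unplayed // subn_eq0.
case: leqP => [leXh | ltXh].
  by apply/winsP/win => //; split=> //; apply/eqP; rewrite eqn_leq szh.
case: eqP => mp; last by apply/forall_inP=> x hx; apply: forces_rcons.
have unplayed_sigma : sigma h \in unplayed h by rewrite in_unplayed leg.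
by apply/exists_inP; exists (sigma h); last exact: forces_rcons.
Qed.

Definition forcing_strategy first p (x0 : X) : strategy X := fun h =>
  if [pick x in unplayed h | forces_after first p (rcons h x)] is Some x then x
  else odflt x0 [pick x in unplayed h].

Lemma legal_forcing_strategy first p x0 :
  legal first p (forcing_strategy first p x0).
Proof.
move=> h uh ltXh _; rewrite -in_unplayed /forcing_strategy.
case: pickP => [x /andP[] //|_]; case: pickP => [//|unplayed0].
by move: ltXh; rewrite -subn_gt0 -card_unplayed // eq_card0.
Qed.

Lemma forces_after_forcing_strategy first p x0 h :
  unplayed h != set0 -> mover first (size h) = p -> forces_after first p h ->
  forces_after first p (rcons h (forcing_strategy first p x0 h)).
Proof.
move=> /negPf nend mp; rewrite forces_afterE nend mp eqxx => /existsP[y win].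
by rewrite /forcing_strategy; case: pickP => [x /andP[] //|/(_ y)]; rewrite win.
Qed.

Lemma forces_winning_strategy first p (x0 : X) :
  forces (winning_set p) (first == p) setT set0 ->
  has_winning_strategy X first p.
Proof.
rewrite -forces_after_nil => win; exists (forcing_strategy first p x0).
split=> [|s cs fol]; first exact: legal_forcing_strategy.
apply: forces_after_complete => //.
suff forces_prefix h : prefix h s -> forces_after first p h.
  exact: forces_prefix (prefix_refl s).
elim/last_ind: h => [//|h x IHh] pre.
have {}IHh := IHh (prefix_trans (prefix_rcons h x) pre).
have hx : x \in unplayed h.
  have [us _] := cs; rewrite in_unplayed.
  by have := prefix_uniq pre us; rewrite rcons_uniq => /andP[].
have nend : unplayed h != set0 by apply/set0Pn; exists x.
have [mp | mp] := eqVneq (mover first (size h)) p.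
  by rewrite (fol h x pre mp) forces_after_forcing_strategy.
by move: IHh; rewrite forces_afterE (negPf nend) (negPf mp) => /forall_inP; apply.
Qed.
End ResolvingGame.

(** * Distances in the lexicographic product *)

Section Distance.
Variable X : sgraph.
Implicit Types x y z : X.

Lemma walk_of_length0 x y : walk_of_length x y 0 = (x == y).
Proof.
apply/existsP/idP => [[p]|xy]; first by rewrite tuple0.
by exists [tuple]; rewrite /= xy.
Qed.

Lemma walk_of_lengthS x y k :
  walk_of_length x y k.+1 = [exists z, adj x z && walk_of_length z y k].
Proof.
apply/existsP/existsP => [[p]|[z /andP[xz /existsP[p walk]]]].
  case/tupleP: p => z p /= /andP[/andP[xz walk] end_y].
  by exists z; rewrite xz; apply/existsP; exists p; rewrite walk.
by exists [tuple of z :: p]; rewrite /= xz.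
Qed.

Lemma walk_of_length1 x y : walk_of_length x y 1 = adj x y.
Proof.
rewrite walk_of_lengthS; apply/existsP/idP => [[z]|xy].
  by rewrite walk_of_length0 => /andP[xz /eqP <-].
by exists y; rewrite xy walk_of_length0 eqxx.
Qed.

Lemma dist_leq x y k : walk_of_length x y k -> dist x y <= k.
Proof.
move=> walk; rewrite leqNgt; apply/negP=> lt.
have ltkX : k < #|X|.
  by apply: leq_trans lt _; rewrite -[leqRHS](size_iota 0) find_size.
by have := before_find 0 lt; rewrite nth_iota // add0n walk.
Qed.

Lemma minn_dist2 x y :
  minn (dist x y) 2 = if x == y then 0 else if adj x y then 1 else 2.
Proof.
have [<- | xy] := eqVneq x y.
  by have := @dist_leq x x 0; rewrite walk_of_length0 eqxx leqn0 => /(_ isT)/eqP->.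
have : 1 < #|X| by apply/card_gt1P; exists x, y.
rewrite /dist; case: #|X| => [//|[//|n]] _ /=.
by rewrite walk_of_length0 walk_of_length1 (negPf xy); case: adj.
Qed.

Definition no_isolated_vertex : Prop := forall x, exists y, adj x y.

Lemma connected_no_isolated_vertex :
  connected X -> 1 < #|X| -> no_isolated_vertex.
Proof.
move=> con gt1 x; have [y _ yx] : exists2 y, y \in X & y != x.
  by move: gt1; rewrite (cardD1 x) inE ltnS => /card_gt0P[y /andP[yx _]]; exists y.
have /connectP[[|z p] /= walk last_y] := con x y.
  by rewrite last_y eqxx in yx.
by exists z; case/andP: walk.
Qed.
End Distance.

Section LexDistance.
Variables G H : sgraph.
Hypothesis noisoH : no_isolated_vertex H.
Notation GH := (lex_product G H).
Implicit Types (g : G) (h k : H).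

Lemma walk_lex_other_copy g h h' (z : GH) n : z.1 != g ->
  walk_of_length ((g, h) : GH) z n -> walk_of_length ((g, h') : GH) z n.
Proof.
move=> zg; elim: n h h' => [|n IHn] h h'.
  by rewrite walk_of_length0 => /eqP ez; rewrite -ez eqxx in zg.
rewrite !walk_of_lengthS => /existsP[[g2 h2] /andP[/= e walk]].
apply/existsP; have [gg2|ngg2] := boolP (adj g g2).
  by exists (g2, h2); rewrite walk /= /lex_adj /= gg2.
move: e; rewrite /lex_adj /= (negPf ngg2) /= => /andP[/eqP eg _].
rewrite -eg in walk; have [h'' e''] := noisoH h'.
by exists (g, h''); rewrite (IHn _ h'' walk) /= /lex_adj /= eqxx e'' orbT.
Qed.

Lemma dist_lex_other_copy g h h' (z : GH) : z.1 != g ->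
  dist ((g, h) : GH) z = dist ((g, h') : GH) z.
Proof.
by move=> zg; apply: eq_find => n; apply/idP/idP; apply: walk_lex_other_copy.
Qed.

Hypothesis noisoG : no_isolated_vertex G.

Lemma dist_lex_same_copy g h k :
  dist ((g, h) : GH) (g, k) = minn (dist h k) 2.
Proof.
have [g' gg'] := noisoG g.
have walk2 : walk_of_length ((g, h) : GH) (g, k) 2.
  rewrite walk_of_lengthS; apply/existsP; exists (g', h).
  by rewrite walk_of_length1 /= /lex_adj /= gg' adj_sym gg'.
rewrite -(minn_idPl (dist_leq walk2)) !minn_dist2 xpair_eqE eqxx /=.
by rewrite /lex_adj /= adj_irrefl eqxx.
Qed.

Lemma resolving_lex_copy (W : {set GH}) g :
  resolving W -> resolving (pair g @^-1: W).
Proof.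
move=> resW h h' hh'.
have /resW[[g' k] Wz] : ((g, h) : GH) != (g, h').
  by apply: contraNneq hh' => -[->].
have [eg | g'g] := eqVneq g' g; last by rewrite (dist_lex_other_copy h h') ?eqxx.
rewrite {}eg !dist_lex_same_copy in Wz * => distk; exists k; first by rewrite inE.
by apply: contraNneq distk => ->.
Qed.

Lemma lex_copy_inj g : injective (pair g : H -> GH).
Proof. by move=> h h' []. Qed.

Lemma winning_set_lex_copy g (S : {set H}) :
  winning_set Spoiler S -> @winning_set GH Spoiler (pair g @: S).
Proof.
apply: contra => /resolvingP/(resolving_lex_copy g) res; apply/resolvingP.
apply: resolvingS res; apply/subsetP=> h.
by rewrite !inE (mem_imset _ _ (@lex_copy_inj g)).
Qed.

Lemma forces_lex_copy g (F : {set GH}) b : (forall h, (g, h) \in F) ->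
  forces (@winning_set H Spoiler) b setT set0 ->
  forces (@winning_set GH Spoiler) b F set0.
Proof.
move=> gF win; have copyF : pair g @: [set: H] \subset F.
  by apply/subsetP=> _ /imsetP[h _ ->].
apply: (forces_sub_board (@winning_setS GH Spoiler) copyF).
rewrite -(imset0 (pair g)); apply: forces_imset win; first exact: lex_copy_inj.
exact: winning_set_lex_copy.
Qed.
End LexDistance.

Theorem theorem3p2 (G H : sgraph)
  (conG : connected G) (conH : connected H)
  (cardG : 2 <= #|G|) (cardH : 2 <= #|H|)
  (oH : has_outcome H OutN \/ has_outcome H OutS) :
  has_outcome (lex_product G H) OutS.
Proof.
have winH : has_winning_strategy H Spoiler Spoiler by case: oH; apply.
have noisoG := connected_no_isolated_vertex conG cardG.
have noisoH := connected_no_isolated_vertex conH cardH.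
have /card_gt0P[g0 _] : 0 < #|G| by apply: leq_trans cardG.
have /card_gt0P[h0 _] : 0 < #|H| by apply: leq_trans cardH.
pose x0 : lex_product G H := (g0, h0).
move=> first; apply: (forces_winning_strategy x0).
apply: forces_to_move; first exact: winning_setS.
rewrite (forces_stepE (in_setT x0)).
apply/forall_inP=> y _; have [g y1g] := noisoG y.1.
apply: (forces_lex_copy noisoH noisoG (g := g)); last first.
  exact: winning_strategy_forces winH.
by move=> h; rewrite !inE andbT; apply: contraTneq y1g => <- /=; rewrite adj_irrefl.
Qed.
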